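(* For every fixed integer $d\ge 2$ there is a constant $c_d>0$ (depending only on $d$) such that for infinitely many values of $n$ there exists an $n$-point set $P\subset\mathbb{R}^d$ with \[ \operatorname{disc}\mathcal{R}_d(P)\ge c_d\log^{d-1}n . \]
   Context: $\mathcal{R}_d$ denotes the family of all axis-parallel boxes $[a_1,b_1]\times\cdots\times[a_d,b_d]$ in $\mathbb{R}^d$, and $\mathcal{R}_d(P)=\{R\cap P: R\in\mathcal{R}_d\}$ is the set system on ground set $P$ induced by them. For a set system $\mathcal{F}$ on a finite ground set $V$, its (combinatorial) discrepancy is $\operatorname{disc}\mathcal{F}=\min_{x\in\{-1,1\}^V}\max_{F\in\mathcal{F}}\bigl|\sum_{v\in F}x_v\bigr|$. *)

(* Defs.v *)
From mathcomp Require Import all_boot all_order all_algebra.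
From mathcomp Require Import boolp.
From Stdlib Require Reals.
From mathcomp Require Import Rstruct.
Notation R := Rdefinitions.R.
Set Implicit Arguments. Unset Strict Implicit. Unset Printing Implicit Defensive.
Import Order.TTheory GRing.Theory Num.Theory.

(* Points of R^d are row vectors 'rV[R]_d over Stdlib's reals R.
   An n-point set is given as an injective map p : 'I_n -> 'rV[R]_d. *)

Definition in_box (d : nat) (a b x : 'rV[R]_d) : Prop :=
  forall i : 'I_d, (a ord0 i <= x ord0 i)%R /\ (x ord0 i <= b ord0 i)%R.

Definition box_induced (d n : nat) (p : 'I_n -> 'rV[R]_d) (S : {set 'I_n}) : Prop :=
  exists a b : 'rV[R]_d, forall k : 'I_n, k \in S <-> in_box a b (p k).

Definition col_sum (n : nat) (x : {ffun 'I_n -> bool}) (S : {set 'I_n}) : int :=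
  (\sum_(k in S) (if x k then 1 else -1 : int))%R.

Definition box_disc_of (d n : nat) (p : 'I_n -> 'rV[R]_d) (x : {ffun 'I_n -> bool}) : nat :=
  \max_(S : {set 'I_n} | `[< box_induced p S >]) `|col_sum x S|%N.

Definition box_disc (d n : nat) (p : 'I_n -> 'rV[R]_d) : nat :=
  \big[minn/box_disc_of p [ffun => true]]_(x : {ffun 'I_n -> bool}) box_disc_of p x.

(* Main.v *)
Require Import Defs.
From mathcomp Require Import all_boot all_order all_algebra.
From Stdlib Require Reals.
From mathcomp Require Import Rstruct.
From mathcomp Require Import all_fingroup boolp ring zify.
Set Implicit Arguments. Unset Strict Implicit. Unset Printing Implicit Defensive.
Import Order.TTheory GRing.Theory Num.Theory.
Local Open Scope ring_scope.

(** If every subset of a point set has box discrepancy at most D, then every k x k minor of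
    its incidence matrix with boxes is at most (2D+1)^k (Lovász, Spencer, Vesztergombi).  So
    it suffices to find a large minor of the matrix A of the boxes anchored at the origin
    against the grid [4 2^m]^d.  Let U and V have as rows the k ~ 2^m m^(d-1) tensor products
    of Walsh (-++-), respectively Haar (++--), functions on the dyadic boxes of volume 2^-m.
    Both families are orthogonal.  In one dimension A V^T consists of tent functions; the
    Walsh function of I annihilates the tent over J when J is longer than I, or as long as
    but distinct from I, because the tent is affine on I.  As all the boxes have the same
    volume, U A V^T is a scalar matrix.  Expanding its determinant twice by Cauchy-Binet and
    using Cauchy-Schwarz on the minors of U and V, some k x k minor of A is at least
    k! / (8^d 2^m)^k, and k!^(1/k) >= k/4 gives D >= c m^(d-1). *)

(** * Cauchy-Binet and bounds on determinants by minors *)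

Lemma det_mulmx_ffun (R : comNzRingType) k n (A : 'M[R]_(k, n)) (B : 'M[R]_(n, k)) :
  \det (A *m B) =
  \sum_(f : {ffun 'I_k -> 'I_n}) (\prod_i A i (f i)) * \det (rowsub f B).
Proof.
transitivity (\sum_(s : 'S_k) \sum_(f : {ffun 'I_k -> 'I_n})
    (-1) ^+ s * \prod_i (A i (f i) * B (f i) (s i))).
  apply: eq_bigr => s _; rewrite -big_distrr /=; congr (_ * _).
  rewrite -(bigA_distr_bigA (fun i j => A i j * B j (s i))) /=.
  by apply: eq_bigr => i _; rewrite mxE.
rewrite exchange_big; apply: eq_bigr => f _ /=.
rewrite big_distrr; apply: eq_bigr => s _ /=.
rewrite big_split /= mulrCA; congr (_ * (_ * _)).
by apply: eq_bigr => i _; rewrite mxE.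
Qed.

(* Summing over all maps rather than over k-subsets counts each k-subset k! times
   (non-injective maps contribute zero). *)
Lemma Cauchy_Binet_ffun (R : comNzRingType) k n (A : 'M[R]_(k, n)) (B : 'M[R]_(n, k)) :
  k`!%:R * \det (A *m B) =
  \sum_(f : {ffun 'I_k -> 'I_n}) \det (colsub f A) * \det (rowsub f B).
Proof.
(* Replacing f by its composite with s permutes the rows of [rowsub f B] and costs the sign of s;
   summing over all s then assembles the Leibniz formula of [\det (colsub f A)]. *)
have E (s : 'S_k) : \det (A *m B) = \sum_(f : {ffun 'I_k -> 'I_n})
    ((-1) ^+ s * \prod_i A i (f (s i))) * \det (rowsub f B).
  rewrite det_mulmx_ffun.
  have bijh : bijective (fun f : {ffun 'I_k -> 'I_n} => [ffun i => f (s i)]).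
    exists (fun f : {ffun 'I_k -> 'I_n} => [ffun i => f ((s^-1)%g i)]) => f;
    by apply/ffunP=> i; rewrite !ffunE ?permK ?permKV.
  rewrite (reindex _ (onW_bij _ bijh)); apply: eq_bigr => f _ /=.
  have -> : rowsub [ffun i => f (s i)] B = row_perm s (rowsub f B).
    by apply/matrixP=> i j; rewrite !mxE ffunE.
  rewrite row_permE det_mulmx det_perm mulrCA mulrA; congr (_ * _ * _).
  by apply: eq_bigr => i _; rewrite ffunE.
rewrite -card_Sn mulr_natl -sumr_const.
under eq_bigr => s _ do rewrite (E s).
rewrite exchange_big; apply: eq_bigr => f _ /=.
rewrite -big_distrl; congr (_ * _); apply: eq_big => [s|s _].
  by rewrite inE.
by congr (_ * _); apply: eq_bigr => i _; rewrite mxE.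
Qed.

(** Cauchy-Schwarz against the all-ones vector, by summing 2 a b <= a^2 + b^2 over all pairs. *)
Lemma sqr_sum_le_card (R : realDomainType) (T : finType) (a : T -> R) :
  (\sum_f a f) ^+ 2 <= #|T|%:R * \sum_f a f ^+ 2.
Proof.
rewrite -(ler_pM2l (ltr0Sn R 1)).
have -> : 2 * (\sum_f a f) ^+ 2 = \sum_f \sum_g (2 * (a f * a g)).
  rewrite expr2 big_distrlr /= big_distrr; apply: eq_bigr => f _ /=.
  by rewrite big_distrr.
have -> : 2 * (#|T|%:R * \sum_f a f ^+ 2) = \sum_f \sum_g (a f ^+ 2 + a g ^+ 2).
  have E f : \sum_g (a f ^+ 2 + a g ^+ 2) = #|T|%:R * a f ^+ 2 + \sum_g a g ^+ 2.
    by rewrite big_split /= sumr_const mulr_natl.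
  rewrite (eq_bigr _ (fun f _ => E f)) big_split /= sumr_const -big_distrr /=.
  by rewrite -(mulr_natl (\sum_f a f ^+ 2)) mulr_natl mulr2n.
apply: ler_sum => f _; apply: ler_sum => g _.
rewrite -subr_ge0; have -> : a f ^+ 2 + a g ^+ 2 - 2 * (a f * a g) = (a f - a g) ^+ 2.
  by rewrite sqrrB mulr_natl addrAC.
exact: sqr_ge0.
Qed.

(** Cauchy-Schwarz over the n^k maps, after which Cauchy-Binet evaluates the sum of the squared
    minors. *)
Lemma sum_minors_sqr_le (R : realDomainType) k n (U : 'M[R]_(k, n)) :
  (\sum_(f : {ffun 'I_k -> 'I_n}) `|\det (colsub f U)|) ^+ 2 <=
  (n ^ k * k`!)%:R * \det (U *m U^T).
Proof.
apply: le_trans (sqr_sum_le_card _) _.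
rewrite card_ffun !card_ord natrM -mulrA Cauchy_Binet_ffun.
rewrite ler_wpM2l ?ler0n //; apply: ler_sum => f _.
have -> : rowsub f U^T = (colsub f U)^T by apply/matrixP=> i j; rewrite !mxE.
by rewrite det_tr real_normK ?num_real // expr2.
Qed.

Lemma det_bilinear_le (R : realDomainType) k n1 n2 (U : 'M[R]_(k, n1)) (A : 'M[R]_(n1, n2))
    (V : 'M[R]_(k, n2)) (M : R) :
    (forall (f : 'I_k -> 'I_n1) (g : 'I_k -> 'I_n2), `|\det (mxsub f g A)| <= M) ->
  k`!%:R ^+ 2 * `|\det (U *m A *m V^T)| <=
  M * ((\sum_(f : {ffun 'I_k -> 'I_n1}) `|\det (colsub f U)|) *
       (\sum_(g : {ffun 'I_k -> 'I_n2}) `|\det (colsub g V)|)).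
Proof.
move=> AM; rewrite -[_ ^+ 2]ger0_norm ?exprn_ge0 ?ler0n // -normrM expr2 -mulrA.
rewrite -mulmxA Cauchy_Binet_ffun big_distrr /=.
have -> : \sum_(f : {ffun 'I_k -> 'I_n1})
     k`!%:R * (\det (colsub f U) * \det (rowsub f (A *m V^T))) =
   \sum_(f : {ffun 'I_k -> 'I_n1}) \sum_(g : {ffun 'I_k -> 'I_n2})
      \det (colsub f U) * (\det (mxsub f g A) * \det (colsub g V)).
  apply: eq_bigr => f _; rewrite mulrCA -big_distrr; congr (_ * _).
  have -> : rowsub f (A *m V^T) = rowsub f A *m V^T.
    by apply/matrixP => i j; rewrite !mxE; apply: eq_bigr => l _; rewrite !mxE.
  rewrite Cauchy_Binet_ffun; apply: eq_bigr => g _; congr (\det _ * _).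
    by apply/matrixP => i j; rewrite !mxE.
  by rewrite -det_tr; congr (\det _); apply/matrixP => i j; rewrite !mxE.
rewrite big_distrlr /= big_distrr /=.
apply: le_trans (ler_norm_sum _ _ _) _; apply: ler_sum => f _.
rewrite big_distrr /=.
apply: le_trans (ler_norm_sum _ _ _) _; apply: ler_sum => g _.
by rewrite !normrM mulrCA ler_wpM2r // mulr_ge0.
Qed.

(* The factor k! is what improves the bound log^((d-1)/2) of the L2 method to log^(d-1). *)
Lemma fact_det_bilinear_le (R : realDomainType) k n (U : 'M[R]_(k, n)) (A : 'M[R]_n)
    (V : 'M[R]_(k, n)) (M G : R) :
    0 <= M -> (forall f g : 'I_k -> 'I_n, `|\det (mxsub f g A)| <= M) ->
    \det (U *m U^T) = G -> \det (V *m V^T) = G ->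
  k`!%:R * `|\det (U *m A *m V^T)| <= M * ((n ^ k)%:R * G).
Proof.
move=> M0 AM UG VG; have k0 : 0 < k`!%:R :> R by rewrite ltr0n fact_gt0.
have {}AM := det_bilinear_le U V AM.
have := sum_minors_sqr_le U; have := sum_minors_sqr_le V; rewrite UG VG.
move: AM; set x := \sum_f _; set y := \sum_g _ => AM xG yG.
have x0 : 0 <= x by apply: sumr_ge0.
have y0 : 0 <= y by apply: sumr_ge0.
have T0 : 0 <= (n ^ k * k`!)%:R * G by apply: le_trans xG; rewrite sqr_ge0.
have xy : x * y <= (n ^ k * k`!)%:R * G.
  (* The two Gram determinants agree, so x^2 and y^2 have the same bound, which therefore also
     bounds x y. *)
  suff: (x * y) ^+ 2 <= ((n ^ k * k`!)%:R * G) ^+ 2 by rewrite ler_sqr ?nnegrE //; apply: mulr_ge0.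
  by rewrite exprMn [X in _ <= X]expr2 ler_pM ?sqr_ge0.
rewrite -(ler_pM2l k0) [X in X <= _]mulrA -expr2; apply: le_trans AM _.
apply: le_trans (ler_wpM2l M0 xy) _; rewrite natrM.
by rewrite le_eqVlt; apply/orP; left; apply/eqP; ring.
Qed.

(** * Determinants and hereditary discrepancy *)

(* A parity-prescribed integral vector plays the role of a colouring of the
   columns in O; only the parities matter for the rounding below. *)
Definition herdisc_le k (B : 'M[int]_k) (D : nat) : Prop :=
  forall O : pred 'I_k, exists2 c : 'cV[int]_k,
    (forall j, (2 %| c j ord0 - (O j)%:R)%Z) & forall i, `|(B *m c) i ord0| <= D%:Z.

(** Binary digits are rounded one at a time: a vector c that is odd exactly where z is odd makes z +
    c even, and halving leaves t digits. The error obeys E(t+1) <= 2 E(t) + D. *)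
Lemma dyadic_rounding k (B : 'M[int]_k) (D : nat) : herdisc_le B D ->
  forall t (z : 'cV[int]_k), exists y : 'cV[int]_k,
    forall i, `|(B *m (z - (2 ^ t)%:Z *: y)) i ord0| <= ((2 ^ t).-1 * D)%:Z.
Proof.
move=> hB; elim=> [|t IH] z.
  by exists z => i; rewrite scale1r subrr mulmx0 mxE normr0.
have [c c_par cD] := hB (fun j => ~~ (2 %| z j ord0)%Z).
have half (a b : int) : (2 %| b - (~~ (2 %| a)%Z)%:R)%Z -> a = 2 * ((a + b) %/ 2)%Z - b.
  by case: (boolP (2 %| a)%Z) => /=; rewrite ?subr0; lia.
pose z' : 'cV[int]_k := \col_j ((z j ord0 + c j ord0) %/ 2)%Z.
have zE : z = 2 *: z' - c.
  by apply/matrixP=> i j; rewrite ord1 !mxE; apply: half.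
have [y yD] := IH z'; exists y => i.
have -> : z - (2 ^ t.+1)%:Z *: y = 2 *: (z' - (2 ^ t)%:Z *: y) - c.
  by rewrite zE scalerBr scalerA expnS PoszM addrAC.
rewrite mulmxBr -scalemxAr.
move: (yD i) (cD i); move: (B *m c) (B *m (z' - _)) => P Q; rewrite !mxE.
move: (P i ord0) (Q i ord0) => a b.
have := expn_gt0 2 t; rewrite expnS.
nia.
Qed.

(* The Smith normal form of B identifies its cokernel with a product of cyclic groups
   of orders d_i, of which the cube of integral vectors of norm at most D hits every element. *)
Lemma absz_det_le_covering k (B : 'M[int]_k) (D : nat) : \det B != 0 ->
    (forall u : 'cV[int]_k, exists y : 'cV[int]_k,
      forall i, `|(u - B *m y) i ord0| <= D%:Z) ->
  (`|\det B| <= (2 * D).+1 ^ k)%N.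
Proof.
have [L Lu [R Ru [d _ ->]]] := int_Smith_normal_form B.
set S := (\matrix_(i, j) _) => det0 cover.
have SE : S = diag_mx (\row_i d`_i).
  by apply/matrixP=> i j; rewrite !mxE -val_eqE.
have absu (M : 'M[int]_k) : M \in unitmx -> `|\det M|%N = 1%N.
  by rewrite unitmxE qualifE => /orP[] /eqP ->.
have detE : `|\det (L *m S *m R)|%N = (\prod_(i < k) `|nth 0%R d i|)%N.
  rewrite !det_mulmx !abszM (absu L) // (absu R) // mul1n muln1 SE det_diag.
  rewrite (big_morph absz abszM (erefl : `|1|%N = 1%N)).
  by apply: eq_bigr => i _; rewrite mxE.
have d0 (i : 'I_k) : d`_i != 0.
  apply: contraNneq det0 => di; rewrite -absz_eq0 detE.
  by rewrite (bigD1 i) //= di.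
pose X := {dffun forall i : 'I_k, 'I_(`|nth 0%R d i|)}.
have modlt (a b : int) : b != 0 -> (`|(a %% b)%Z| < `|b|)%N by lia.
(* The shift by D lets the indices 0, ..., 2D encode the coordinates -D, ..., D of the cube. *)
pose vec (w : {ffun 'I_k -> 'I_(2 * D).+1}) : 'cV[int]_k := \col_j ((w j : nat)%:Z - D%:Z).
pose phi w : X := [ffun i : 'I_k => Ordinal (modlt ((invmx L *m vec w) i ord0) _ (d0 i))].
rewrite detE; have -> : (\prod_(i < k) `|nth 0%R d i|)%N = #|X|.
  rewrite card_dep_ffun foldrE big_map big_enum /=.
  by apply: eq_bigr => i _; rewrite card_ord.
have -> : ((2 * D).+1 ^ k)%N = #|{ffun 'I_k -> 'I_(2 * D).+1}|.
  by rewrite card_ffun !card_ord.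
suff sub : {subset X <= codom phi}.
  apply: leq_trans (subset_leq_card (introT subsetP sub)) _.
  exact: leq_image_card.
move=> r _; have [y yD] := cover (L *m \col_i (r i : nat)%:Z).
(* A representative of the class of r inside the cube: applying L^-1 gives r - S R y, which is r
   modulo the d_i. *)
pose v : 'cV[int]_k := L *m \col_i (r i : nat)%:Z - L *m S *m R *m y.
pose w : {ffun 'I_k -> 'I_(2 * D).+1} := [ffun j => inord `|(v j ord0 + D%:Z)%R|%N].
have shiftK (a : int) : `|a| <= D%:Z -> (inord `|(a + D%:Z)%R|%N : 'I_(2 * D).+1)%:Z - D%:Z = a.
  by move=> aD; rewrite inordK; lia.
have vE : vec w = v.
  by apply/matrixP=> i j; rewrite ord1 [LHS]mxE ffunE shiftK.
apply/codomP; exists w; apply/ffunP=> i; apply: val_inj; rewrite ffunE /= vE /v.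
rewrite -!mulmxA mulmxBr !mulKmx // SE mul_diag_mx !mxE.
rewrite addrC mulrC -mulNr modzMDl -modz_abs modz_small //.
by have := ltn_ord (r i); lia.
Qed.

(* The rational vector B^-1 u is scaled by 2^k and truncated before rounding; truncation
   perturbs each coordinate of the image by at most k, which is less than 2^k. *)
Lemma absz_det_le_herdisc k (B : 'M[int]_k) (D : nat) :
  (forall i j, `|B i j| <= 1) -> herdisc_le B D ->
  (`|\det B| <= (2 * D).+1 ^ k)%N.
Proof.
move=> B1 hB; have [->|det0] := eqVneq (\det B) 0; first by rewrite absz0.
apply: absz_det_le_covering => // u.
have kt : (k < 2 ^ k)%N by apply: ltn_expl.
(* x / det B is 2^k B^-1 u; its truncation is z, with remainder e / det B. *)
have [x xE] : exists x : 'cV[int]_k, x = (2 ^ k)%:Z *: (\adj B *m u) by eexists.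
pose z : 'cV[int]_k := \col_i (x i ord0 %/ \det B)%Z.
pose e : 'cV[int]_k := \col_i (x i ord0 %% \det B)%Z.
have xze : x = \det B *: z + e.
  by apply/matrixP=> i j; rewrite ord1 !mxE mulrC -divz_eq.
have [y yD] := dyadic_rounding hB k z; exists y => i.
have BzE : \det B *: (B *m z) = \det B *: ((2 ^ k)%:Z *: u) - B *m e.
  rewrite scalemxAr -[_ *: z](addrK e) -xze mulmxBr; congr (_ - _).
  by rewrite xE -scalemxAr mulmxA mul_mx_adj mul_scalar_mx !scalerA mulrC.
have modle (a b : int) : b != 0 -> `|(a %% b)%Z| <= `|b| by lia.
have Be : `|(B *m e) i ord0| <= k%:Z * `|\det B|.
  rewrite mxE; apply: le_trans (ler_norm_sum _ _ _) _.
  apply: le_trans (_ : \sum_(j < k) `|\det B| <= _); last first.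
    by rewrite sumr_const card_ord -mulr_natl natz.
  by apply: ler_sum => j _; rewrite normrM -[X in _ <= X]mul1r ler_pM // mxE modle.
have {BzE} := congr1 (fun M : 'cV[int]_k => M i ord0) BzE.
move: (yD i) Be; rewrite mulmxBr -!scalemxAr.
move: (B *m z) (B *m y) (B *m e) (\det B) det0 => P Q S b b0; rewrite !mxE.
move: (P i ord0) (Q i ord0) (S i ord0) (u i ord0) => p q s a.
move: (2 ^ k)%N kt => T kT pq sb bp.
have {bp sb} ap : `|T%:Z * a - p| <= k%:Z.
  rewrite -(ler_pM2l (_ : 0 < `|b|)) ?normr_gt0 // -normrM mulrBr bp opprB addrC subrK.
  by rewrite mulrC.
have T0 : 0 < T%:Z by lia.
(* Truncation costs at most k and rounding (T - 1) D; since k < T, the total is below T (D + 1), and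
   integrality then gives the bound D. *)
have TD : (T.-1 * D)%:Z + k%:Z < T%:Z * (D%:Z + 1) by nia.
suff : `|a - q| < D%:Z + 1 by lia.
rewrite -(ltr_pM2l T0) -{1}[T%:Z]ger0_norm -?normrM; last exact: ltW.
by apply: le_lt_trans TD; rewrite mulrBr; lia.
Qed.

(** * Walsh and Haar waves in one dimension *)

Lemma sum_ord_mul (V : nmodType) a b (F : nat -> V) :
  \sum_(x < a * b) F x = \sum_(i < a) \sum_(j < b) F (i * b + j)%N.
Proof.
elim: a F => [|a IH] F; first by rewrite mul0n !big_ord0.
rewrite big_ord_recr /= -IH mulSnr -!(big_mkord xpredT F).
rewrite (@big_cat_nat _ _ _ (a * b)) ?leq_addr //=; congr (_ + _).
rewrite -[X in \sum_(X <= i < _) _]add0n [(a * b + b)%N]addnC.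
rewrite big_addn addnK big_mkord.
by apply: eq_bigr => i _; rewrite addnC.
Qed.

(* Supported on [4qp, 4q(p+1)), with the values s 0, ..., s 3 on its four quarters. *)
Definition wave (s : nat -> int) (q p x : nat) : int :=
  if (x %/ (4 * q) == p)%N then s ((x %/ q) %% 4)%N else 0.

Definition haar_sign (t : nat) : int := if (t < 2)%N then 1 else -1.

(* The pattern -++- annihilates affine functions. *)
Definition walsh_sign (t : nat) : int := if (0 < t < 3)%N then 1 else -1.

Lemma waveE s q i t b p : (t < 4)%N -> (b < q)%N ->
  wave s q p (i * (4 * q) + (t * q + b))%N = if i == p then s t else 0.
Proof.
move=> t4 bq; have q0 : (0 < q)%N by apply: leq_ltn_trans bq.
rewrite /wave divnMDl ?muln_gt0 // divn_small ?addn0; last by nia.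
case: eqP => // _; rewrite mulnA addnA -mulnDl divnMDl // divn_small // addn0.
by rewrite modnMDl modn_small.
Qed.

(** Only block p contributes. With the offset b outermost, each b leaves a sum over the four
    quarters, where all the cancellation takes place. *)
Lemma sum_wave s q P p (F : nat -> int) : (p < P)%N ->
  \sum_(x < (P * (4 * q))%N) wave s q p x * F x =
  \sum_(b < q) \sum_(t < 4) s t * F (p * (4 * q) + (t * q + b))%N.
Proof.
move=> pP; rewrite (sum_ord_mul P (4 * q) (fun x => wave s q p x * F x)).
rewrite (bigD1 (Ordinal pP)) //= [X in _ + X]big1 ?addr0; last first.
  move=> i /negPf ip; rewrite (sum_ord_mul 4 q (fun j => wave s q p (i * (4 * q) + j)%N * F (i * (4 * q) + j)%N)).
  rewrite big1 // => t _; rewrite big1 // => b _.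
  by rewrite waveE // -[p]/(val (Ordinal pP)) val_eqE ip mul0r.
rewrite (sum_ord_mul 4 q (fun j => wave s q p (p * (4 * q) + j)%N * F (p * (4 * q) + j)%N)).
rewrite exchange_big /=; apply: eq_bigr => b _; apply: eq_bigr => t _.
by rewrite waveE // eqxx.
Qed.

Lemma sum_wave_same s q P p : (p < P)%N -> (forall t, s t * s t = 1) ->
  \sum_(x < (P * (4 * q))%N) wave s q p x * wave s q p x = (4 * q)%:Z.
Proof.
move=> pP ss; rewrite sum_wave //.
rewrite (eq_bigr (fun=> 4)); first by rewrite sumr_const card_ord -[_ *+ q]mulr_natr natz; lia.
move=> b _; rewrite (eq_bigr (fun=> 1)) ?sumr_const ?card_ord //.
by move=> t _; rewrite waveE // eqxx ss.
Qed.

Lemma sum_wave_disjoint s s' q P p p' : (p < P)%N -> p != p' ->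
  \sum_(x < (P * (4 * q))%N) wave s q p x * wave s' q p' x = 0.
Proof.
move=> pP /negPf pp'; rewrite sum_wave // big1 // => b _; rewrite big1 // => t _.
by rewrite waveE // pp' mulr0.
Qed.

(** Quarters of the coarser wave have length 2qe, so it is constant on each half of block p, and -+
    and +- both sum to zero. *)
Lemma sum_walsh_coarse q e P p p' s : (p < P)%N -> (0 < e)%N ->
  \sum_(x < (P * (4 * q))%N) wave walsh_sign q p x * wave s (2 * q * e)%N p' x = 0.
Proof.
move=> pP e0; rewrite sum_wave // big1 // => b _.
have q0 : (0 < q)%N by apply: leq_ltn_trans (ltn_ord b).
pose G y := wave s e p' y.
have FE t : (t < 4)%N -> wave s (2 * q * e)%N p' (p * (4 * q) + (t * q + b))%N = G (2 * p + t %/ 2)%N.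
  move=> t4; rewrite /G /wave.
  have E : ((p * (4 * q) + (t * q + b)) %/ (2 * q) = 2 * p + t %/ 2)%N.
    have -> : (p * (4 * q) + (t * q + b) = (2 * p + t %/ 2) * (2 * q) + (t %% 2 * q + b))%N.
      by rewrite {1}(divn_eq t 2); ring.
    have small : (t %% 2 * q + b < 2 * q)%N.
      by have := ltn_ord b; have := ltn_pmod t (isT : 0 < 2)%N; nia.
    by rewrite divnMDl ?muln_gt0 // (divn_small small) addn0.
  have -> : (4 * (2 * q * e) = 2 * q * (4 * e))%N by ring.
  by rewrite !(divnMA _ (2 * q)) E.
rewrite !big_ord_recl big_ord0 /= !FE //= /walsh_sign /=.
by ring.
Qed.

(** A Haar wave sees x only through its half-block of length 2q; this makes it constant over whole
    blocks at finer scales. *)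
Lemma haarE q p x : wave haar_sign q p x =
  if ((x %/ (2 * q)) %/ 2 == p)%N then (-1) ^+ odd (x %/ (2 * q)) else 0.
Proof.
rewrite /wave -divnMA [(2 * q * 2)%N]mulnAC -[(2 * 2)%N]/4%N; case: eqP => // _.
rewrite [(2 * q)%N]mulnC divnMA /haar_sign; set t := (x %/ q)%N.
have -> : odd (t %/ 2) = ~~ (t %% 4 < 2)%N by lia.
by case: ltnP.
Qed.

(** At scale 2qe the half-blocks have length 4qe, so none of them cuts a block of length 4q; at the
    same scale the wave of another block vanishes on block p. *)
Lemma haar_const q q' p p' c : (c < 4 * q)%N ->
    (exists2 e, (0 < e)%N & q' = (2 * q * e)%N) \/ (q' = q /\ p != p') ->
  wave haar_sign q' p' (p * (4 * q) + c)%N = wave haar_sign q' p' (p * (4 * q))%N.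
Proof.
move=> cq [[e e0 ->]|[-> /negPf pp']]; last first.
  have q0 : (0 < 4 * q)%N by apply: leq_ltn_trans cq.
  by rewrite /wave divnMDl // mulnK // divn_small // addn0 pp'.
have q0 : (0 < 4 * q)%N by apply: leq_ltn_trans cq.
rewrite !haarE; have -> : (2 * (2 * q * e) = 4 * q * e)%N by ring.
by rewrite !(divnMA _ (4 * q)) divnMDl // mulnK // (divn_small cq) addn0.
Qed.

Lemma sum_haar_const q q' P p p' : (p < P)%N ->
    (exists2 e, (0 < e)%N & q' = (2 * q * e)%N) \/ (q' = q /\ p != p') ->
  \sum_(x < (P * (4 * q))%N) wave haar_sign q p x * wave haar_sign q' p' x = 0.
Proof.
move=> pP hq; rewrite sum_wave // big1 // => b _.
rewrite !big_ord_recl big_ord0 /= /bump /= !(haar_const _ hq); try by have := ltn_ord b; nia.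
by rewrite /haar_sign /=; ring.
Qed.

(** A discrete antiderivative: that of a Haar wave is a tent function. *)
Definition cumul (h : nat -> int) (y : nat) : int := \sum_(x < y) h x.

Lemma cumul_affine h s n (a : int) : (forall c, (c < n)%N -> h (s + c)%N = a) ->
  forall c, (c <= n)%N -> cumul h (s + c)%N = cumul h s + a * c%:Z.
Proof.
move=> ha; elim=> [|c IH] cn; first by rewrite addn0 mulr0 addr0.
by rewrite addnS /cumul big_ord_recr /= -/(cumul h _) IH 1?ltnW // ha // intS; ring.
Qed.

(** The Haar wave is constant on block p, so the tent is affine there and -++- annihilates it. *)
Lemma sum_walsh_cumul_haar_eq0 q q' P p p' : (p < P)%N ->
    (exists2 e, (0 < e)%N & q' = (2 * q * e)%N) \/ (q' = q /\ p != p') ->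
  \sum_(y < (P * (4 * q))%N) wave walsh_sign q p y * cumul (wave haar_sign q' p') y = 0.
Proof.
move=> pP hq; rewrite sum_wave // big1 // => b _.
have A := cumul_affine (fun c cq => haar_const cq hq).
rewrite !big_ord_recl big_ord0 /= /bump /= !A; try by have := ltn_ord b; nia.
by rewrite /walsh_sign /= /bump /= !PoszD !PoszM; ring.
Qed.

(** At offset b the tent takes the values b, q + b, 2q - b, q - b on the four quarters; the signs
    -++- give 2q for each of the q offsets. *)
Lemma sum_walsh_cumul_haar_same q P p : (p < P)%N ->
  \sum_(y < (P * (4 * q))%N) wave walsh_sign q p y * cumul (wave haar_sign q p) y = (2 * q ^ 2)%:Z.
Proof.
move=> pP; rewrite sum_wave //.
have [->|q0] := posnP q; first by rewrite big_ord0.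
set s := (p * (4 * q))%N; set h := wave haar_sign q p.
have H0 : cumul h s = 0.
  rewrite /cumul big1 // => x _; rewrite /h /wave ltn_eqF //.
  by rewrite ltn_divLR ?muln_gt0 //; apply: ltn_ord.
have hE c : (c < 4 * q)%N -> h (s + c)%N = haar_sign (c %/ q).
  move=> cq; rewrite /h /s [in LHS](divn_eq c q) waveE ?eqxx ?ltn_pmod //.
  by rewrite ltn_divLR.
have H1 c : (c <= 2 * q)%N -> cumul h (s + c)%N = c%:Z.
  move=> cq; rewrite (@cumul_affine h s (2 * q) 1) ?H0 ?add0r ?mul1r //.
  move=> b bq; have b4 : (b < 4 * q)%N by lia.
  by rewrite hE // /haar_sign ltn_divLR // bq.
have H2 c : (c <= 2 * q)%N -> cumul h (s + 2 * q + c)%N = (2 * q)%:Z - c%:Z.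
  move=> cq; rewrite (@cumul_affine h (s + 2 * q) (2 * q) (-1)) ?H1 ?mulN1r //.
  move=> b bq; have b4 : (2 * q + b < 4 * q)%N by lia.
  by rewrite -addnA hE // /haar_sign ltn_divLR // ltnNge leq_addr.
rewrite (eq_bigr (fun=> (2 * q)%:Z)).
  by rewrite sumr_const card_ord -mulr_natl natz -PoszM; congr Posz; nia.
move=> b _; have bq := ltn_ord b.
rewrite !big_ord_recl big_ord0 /= /bump /= /walsh_sign /=.
have -> : (s + ((1 + (1 + 0)) * q + b) = s + 2 * q + b)%N by ring.
have -> : (s + ((1 + (1 + (1 + 0))) * q + b) = s + 2 * q + (q + b))%N by ring.
by rewrite !H1 ?H2; lia.
Qed.

(** The factor 4 leaves blocks of the finest level r = m with four quarters of length 1. *)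
Lemma grid_sizeE m r : (r <= m)%N -> (4 * 2 ^ m = 2 ^ r * (4 * 2 ^ (m - r)))%N.
Proof. by move=> rm; rewrite mulnCA -expnD subnKC. Qed.

Lemma dyadic_coarser m r r' : (r' < r <= m)%N ->
  exists2 e, (0 < e)%N & (2 ^ (m - r') = 2 * 2 ^ (m - r) * e)%N.
Proof.
move=> /andP[rr rm]; exists (2 ^ (r - r').-1)%N; first by rewrite expn_gt0.
by rewrite -expnS -expnD; congr (2 ^ _)%N; lia.
Qed.

Definition orthogonal_waves (s : nat -> int) : Prop :=
  forall m r r' p p', (r <= m)%N -> (r' <= m)%N -> (p < 2 ^ r)%N -> (p' < 2 ^ r')%N ->
  \sum_(x < (4 * 2 ^ m)%N) wave s (2 ^ (m - r))%N p x * wave s (2 ^ (m - r'))%N p' x =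
  if (r == r') && (p == p') then (4 * 2 ^ (m - r))%:Z else 0.

Lemma orthogonal_wavesP (s : nat -> int) : (forall t, s t * s t = 1) ->
    (forall q e P p p', (p < P)%N -> (0 < e)%N ->
      \sum_(x < (P * (4 * q))%N) wave s q p x * wave s (2 * q * e)%N p' x = 0) ->
  orthogonal_waves s.
Proof.
move=> ss coarse m r r' p p' rm rm' pr pr'.
have coarser r1 r2 p1 p2 : (r2 < r1 <= m)%N -> (p1 < 2 ^ r1)%N ->
    \sum_(x < (4 * 2 ^ m)%N) wave s (2 ^ (m - r1))%N p1 x * wave s (2 ^ (m - r2))%N p2 x = 0.
  move=> r12 pr1; have [e e0 ->] := dyadic_coarser r12.
  by rewrite (@grid_sizeE m r1) ?coarse //; case/andP: r12.
case: (ltngtP r r') => [rr'|rr'|rr'] /=.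
- under eq_bigr do rewrite mulrC.
  by rewrite coarser // rr'.
- by rewrite coarser // rr'.
rewrite -rr' (grid_sizeE rm); case: eqP => [<-|/eqP pp'].
  exact: sum_wave_same.
exact: sum_wave_disjoint.
Qed.

Lemma orthogonal_haar : orthogonal_waves haar_sign.
Proof.
apply: orthogonal_wavesP => [t|q e P p p' pP e0].
  by rewrite /haar_sign; case: ifP.
by apply: sum_haar_const => //; left; exists e.
Qed.

Lemma orthogonal_walsh : orthogonal_waves walsh_sign.
Proof.
apply: orthogonal_wavesP => [t|q e P p p' pP e0]; last exact: sum_walsh_coarse.
by rewrite /walsh_sign; case: ifP.
Qed.

(** Summing the indicator over x produces the tent. The case r' <= r is that of a Haar interval at
    least as long as the Walsh one; [box_neq_coarser] supplies a direction of this kind. *)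
Lemma sum_walsh_haar m r r' p p' : (r' <= r <= m)%N -> (p < 2 ^ r)%N ->
  \sum_(y < (4 * 2 ^ m)%N) \sum_(x < (4 * 2 ^ m)%N)
    wave walsh_sign (2 ^ (m - r))%N p y * (x < y)%N%:R * wave haar_sign (2 ^ (m - r'))%N p' x =
  if (r == r') && (p == p') then (2 * (2 ^ (m - r)) ^ 2)%:Z else 0.
Proof.
move=> /andP[rr' rm] pr.
transitivity (\sum_(y < (4 * 2 ^ m)%N) wave walsh_sign (2 ^ (m - r))%N p y *
    cumul (wave haar_sign (2 ^ (m - r'))%N p') y).
  apply: eq_bigr => y _; rewrite /cumul (big_ord_widen _ _ (ltnW (ltn_ord y))).
  rewrite big_distrr /= [RHS]big_mkcond /=; apply: eq_bigr => x _.
  by case: ifP; rewrite ?mulr1 // mulr0 mul0r.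
rewrite (grid_sizeE rm); case: (ltngtP r r') rr' => [//|rr' _|rr' _] /=.
  by rewrite sum_walsh_cumul_haar_eq0 //; left; apply: dyadic_coarser; rewrite rr'.
rewrite -rr'; case: eqP => [<-|/eqP pp'].
  exact: sum_walsh_cumul_haar_same.
by rewrite sum_walsh_cumul_haar_eq0 //; right.
Qed.

(** * Tensor products over dyadic boxes of equal volume *)

Section Grid.
Variables d m : nat.

Notation grid := {ffun 'I_d -> 'I_(4 * 2 ^ m)}.
Notation boxes := ({ffun 'I_d -> 'I_m.+1} * {ffun 'I_d -> 'I_(2 ^ m)})%type.

(* The pair (r, p) encodes the product over i of the p_i-th dyadic intervals of level r_i;
   its relative volume is 2^-m. *)
Definition dyadic_boxes : {set boxes} :=
  [set b : boxes | (\sum_i (b.1 i : nat) == m)%N & [forall i, (b.2 i < 2 ^ b.1 i)%N]].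

Definition box_wave (s : nat -> int) (b : boxes) (x : grid) : int :=
  \prod_i wave s (2 ^ (m - b.1 i))%N (b.2 i) (x i).

Definition below (y x : grid) : bool := [forall i, (x i < y i)%N].

Lemma belowE y x : (below y x)%:R = \prod_i (x i < y i)%N%:R :> int.
Proof.
rewrite /below; case: forallP => [xy|/forallP].
  by rewrite big1 // => i _; rewrite xy.
rewrite negb_forall => /existsP[i /negPf xy].
by rewrite (bigD1 i) //= xy mul0r.
Qed.

Lemma expn_prod_ord a : (a ^ d = \prod_(i < d) a)%N.
Proof. by rewrite prod_nat_const card_ord. Qed.

Lemma sum_box_wave (s : nat -> int) b b' :
  \sum_x box_wave s b x * box_wave s b' x = \prod_i \sum_(x < (4 * 2 ^ m)%N)
    wave s (2 ^ (m - b.1 i))%N (b.2 i) x * wave s (2 ^ (m - b'.1 i))%N (b'.2 i) x.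
Proof.
rewrite bigA_distr_bigA; apply: eq_bigr => x _.
by rewrite /box_wave -big_split.
Qed.

(** The indicator [below] factors over the coordinates, so the double sum is a product of
    one-dimensional ones. *)
Lemma sum_box_below s s' b b' :
  \sum_y \sum_x box_wave s b y * (below y x)%:R * box_wave s' b' x =
  \prod_i \sum_(y < (4 * 2 ^ m)%N) \sum_(x < (4 * 2 ^ m)%N)
    wave s (2 ^ (m - b.1 i))%N (b.2 i) y * (x < y)%N%:R *
    wave s' (2 ^ (m - b'.1 i))%N (b'.2 i) x.
Proof.
rewrite bigA_distr_bigA; apply: eq_bigr => y _.
rewrite bigA_distr_bigA; apply: eq_bigr => x _.
by rewrite belowE /box_wave -!big_split.
Qed.

Lemma sum_colevel b : b \in dyadic_boxes -> (\sum_i (m - b.1 i) = d * m - m)%N.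
Proof.
rewrite inE => /andP[/eqP bm _].
rewrite sumnB; last by move=> i _; rewrite -ltnS.
by rewrite bm sum_nat_const card_ord.
Qed.

(** Independence of b makes the matrices below scalar and not merely diagonal. *)
Lemma prod_colevel b : b \in dyadic_boxes ->
  (\prod_i 2 ^ (m - b.1 i) = 2 ^ (d * m - m))%N.
Proof. by move=> bB; rewrite -expn_sum sum_colevel. Qed.

Lemma dyadic_boxesP b : b \in dyadic_boxes ->
  forall i, (b.1 i <= m)%N /\ (b.2 i < 2 ^ b.1 i)%N.
Proof. by rewrite inE => /andP[_ /forallP bp] i; rewrite -ltnS. Qed.

Lemma box_neqP (b b' : boxes) : b != b' ->
  exists i, ~~ ((b.1 i == b'.1 i :> nat) && (b.2 i == b'.2 i :> nat)).
Proof.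
move=> bb'; apply/existsP; rewrite -negb_forall; apply: contra bb' => /forallP E.
apply/eqP; case: b b' E => [r p] [r' p'] /= E.
by congr (_, _); apply/ffunP=> i; apply: val_inj; case/andP: (E i) => /eqP ? /eqP ?.
Qed.

Lemma box_wave_orthogonal s b b' : orthogonal_waves s ->
    b \in dyadic_boxes -> b' \in dyadic_boxes ->
  \sum_x box_wave s b x * box_wave s b' x = (4 ^ d * 2 ^ (d * m - m))%:Z *+ (b == b').
Proof.
move=> so bB bB'; rewrite sum_box_wave.
have E i := so m _ _ _ _ (dyadic_boxesP bB i).1 (dyadic_boxesP bB' i).1
  (dyadic_boxesP bB i).2 (dyadic_boxesP bB' i).2.
rewrite (eq_bigr _ (fun i _ => E i)); case: eqP => [<-|/eqP/box_neqP[i /negPf bi]]; last first.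
  by rewrite (bigD1 i) //= bi mul0r.
rewrite mulr1n -(prod_colevel bB) (expn_prod_ord 4) -big_split /=.
rewrite (big_morph Posz PoszM (erefl _)).
by apply: eq_bigr => i _; rewrite !eqxx.
Qed.

(* Since both boxes have the same volume, b' cannot be shorter than b in some direction
   without being longer in another one. *)
Lemma box_neq_coarser b b' : b \in dyadic_boxes -> b' \in dyadic_boxes -> b != b' ->
  exists2 i, (b'.1 i <= b.1 i)%N &
    ~~ ((b.1 i == b'.1 i :> nat) && (b.2 i == b'.2 i :> nat)).
Proof.
rewrite !inE => /andP[/eqP bm _] /andP[/eqP bm' _] /box_neqP[i bi].
have [/existsP[j bj]|] := boolP [exists j, (b'.1 j < b.1 j)%N].
  by exists j; [exact: ltnW | rewrite (gtn_eqF bj)].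
rewrite negb_exists => /forallP le; exists i => //; rewrite leqNgt; apply/negP => lti.
suff : (\sum_i b.1 i < \sum_i b'.1 i)%N by rewrite bm bm' ltnn.
rewrite (bigD1 i) //= [X in (_ < X)%N](bigD1 i) //= -addSn leq_add //.
by apply: leq_sum => j _; rewrite leqNgt.
Qed.

(** Off the diagonal, the direction from [box_neq_coarser] gives a zero factor; on it, the factors 2
    q_i^2 multiply, where the product of the q_i is fixed. *)
Lemma box_wave_below b b' : b \in dyadic_boxes -> b' \in dyadic_boxes ->
  \sum_y \sum_x box_wave walsh_sign b y * (below y x)%:R * box_wave haar_sign b' x =
  (2 ^ d * (2 ^ (d * m - m)) ^ 2)%:Z *+ (b == b').
Proof.
move=> bB bB'; rewrite sum_box_below.
case: eqP => [<-|/eqP/(box_neq_coarser bB bB')[i le /negPf bi]]; last first.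
  rewrite (bigD1 i) //= sum_walsh_haar ?bi ?mul0r //; last exact: (dyadic_boxesP bB i).2.
  by rewrite le (dyadic_boxesP bB i).1.
rewrite mulr1n -(prod_colevel bB) (expn_prod_ord 2) -mulnn -!big_split /=.
rewrite (big_morph Posz PoszM (erefl _)); apply: eq_bigr => i _.
have [bm bp] := dyadic_boxesP bB i.
by rewrite sum_walsh_haar ?leqnn ?eqxx //= -mulnn.
Qed.

Lemma sum_enum_val (T : finType) (F : T -> int) :
  \sum_(a < #|T|) F (enum_val a) = \sum_x F x.
Proof. by rewrite -(big_enum_val F). Qed.

Local Notation k := #|dyadic_boxes|.
Local Notation N := #|{: grid}|.

Definition wave_mx s : 'M[int]_(k, N) := \matrix_(a, x) box_wave s (enum_val a) (enum_val x).
Definition below_mx : 'M[int]_N := \matrix_(y, x) (below (enum_val y) (enum_val x))%:R.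

Lemma wave_mx_gram s : orthogonal_waves s ->
  wave_mx s *m (wave_mx s)^T = ((4 ^ d * 2 ^ (d * m - m))%:Z)%:M.
Proof.
move=> so; apply/matrixP=> a b; rewrite !mxE.
under eq_bigr do rewrite !mxE.
rewrite (sum_enum_val (fun x => box_wave s (enum_val a) x * box_wave s (enum_val b) x)).
by rewrite box_wave_orthogonal ?enum_valP // (inj_eq enum_val_inj).
Qed.

Lemma wave_mx_below :
  wave_mx walsh_sign *m below_mx *m (wave_mx haar_sign)^T =
  ((2 ^ d * (2 ^ (d * m - m)) ^ 2)%:Z)%:M.
Proof.
rewrite -mulmxA; apply/matrixP=> a b; rewrite !mxE.
rewrite -(inj_eq enum_val_inj) -box_wave_below ?enum_valP // -[RHS]sum_enum_val.
apply: eq_bigr => y _; rewrite !mxE big_distrr /= -[RHS]sum_enum_val.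
by apply: eq_bigr => x _; rewrite !mxE mulrA.
Qed.

(** The columns are points to be coloured, hence distinct; rows may repeat, since minors are taken
    along arbitrary maps f. *)
Definition herdisc_below_le (D : nat) : Prop :=
  forall l (f g : 'I_l -> grid), injective g ->
  herdisc_le (\matrix_(i, j) (below (f i) (g j))%:R) D.

Lemma minor_below_le D l (f g : 'I_l -> 'I_N) : herdisc_below_le D ->
  `|\det (mxsub f g below_mx)| <= ((2 * D).+1 ^ l)%:Z.
Proof.
move=> hD; have [gi|] := boolP (injectiveb g).
  have := @absz_det_le_herdisc l (mxsub f g below_mx) D.
  have -> : mxsub f g below_mx =
    \matrix_(i, j) (below (enum_val (f i)) (enum_val (g j)))%:R.
    by apply/matrixP=> i j; rewrite !mxE.
  rewrite -abszE lez_nat; apply=> [i j|]; first by rewrite mxE; case: below.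
  by apply: hD => i j /enum_val_inj; apply/injectiveP.
case/injectivePn=> i [j ij gij].
rewrite -det_tr (determinant_alternate ij) ?normr0 // => a.
by rewrite !mxE gij.
Qed.

(** With Q = 2^(dm - m), the grid has 4^d 2^m Q points, the Gram matrices are 4^d Q times the
    identity and U A V^T is 2^d Q^2 times it. Q cancels and 16^d / 2^d = 8^d remains. *)
Lemma fact_dyadic_boxes_le D : (0 < d)%N -> herdisc_below_le D ->
  (k`! <= ((2 * D).+1 * 8 ^ d * 2 ^ m) ^ k)%N.
Proof.
move=> d0 hD.
have := fact_det_bilinear_le (isT : 0 <= ((2 * D).+1 ^ k)%:Z)
  (fun f g => minor_below_le f g hD)
  (congr1 determinant (wave_mx_gram orthogonal_walsh))
  (congr1 determinant (wave_mx_gram orthogonal_haar)).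
rewrite wave_mx_below !det_scalar -!natz -!natrX normr_nat -!natrM ler_nat.
rewrite card_ffun !card_ord.
have -> : ((4 * 2 ^ m) ^ d = 4 ^ d * 2 ^ m * 2 ^ (d * m - m))%N.
  (* Positivity of d gives m <= d m, so the truncated subtraction is exact. *)
  by rewrite expnMn -expnM mulnC -mulnA -expnD subnKC ?leq_pmull // [RHS]mulnC [(m * d)%N]mulnC.
move: (2 ^ (d * m - m))%N (expn_gt0 2 (d * m - m)) => Q Q0.
rewrite -!expnMn.
have -> : ((2 * D).+1 * (4 ^ d * 2 ^ m * Q * (4 ^ d * Q)) =
           (2 * D).+1 * 8 ^ d * 2 ^ m * (2 ^ d * Q ^ 2))%N.
  have -> : (8 ^ d = 4 ^ d * 2 ^ d)%N by rewrite -expnMn.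
  have -> : (4 ^ d = 2 ^ d * 2 ^ d)%N by rewrite -expnMn.
  by ring.
by rewrite [X in (_ <= X)%N]expnMn leq_pmul2r // expn_gt0 muln_gt0 !expn_gt0 Q0.
Qed.
End Grid.

(** * Counting dyadic boxes *)

(** k^k is at most the falling factorial 2k (2k - 1) ... (k + 1) = C(2k, k) k!, and C(2k, k) <=
    4^k. *)
Lemma expnn_le_fact k : (k ^ k <= 4 ^ k * k`!)%N.
Proof.
have ffact_ge j n : (j <= k)%N -> (k + j <= n)%N -> (k ^ j <= n ^_ j)%N.
  elim: j n => [|j IH] n jk kn; first by rewrite ffactn0.
  by case: n kn => [|n] kn; [lia | rewrite ffactSS expnS leq_mul ?IH //; lia].
apply: leq_trans (ffact_ge k (2 * k)%N _ _) _; rewrite ?mul2n ?addnn //.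
rewrite -bin_ffact leq_mul2r; apply/orP; right.
rewrite -[4%N]/((1 + 1) ^ 2)%N -expnM -mul2n expnDn.
have kk : (k < (2 * k).+1)%N by lia.
by rewrite (bigD1 (Ordinal kk)) //= !exp1n !muln1 leq_addr.
Qed.

Lemma card_dyadic_boxes_le d m D : (0 < d)%N -> herdisc_below_le d m D ->
  (#|dyadic_boxes d m| <= 4 * ((2 * D).+1 * 8 ^ d * 2 ^ m))%N.
Proof.
move=> d0 hD; have := fact_dyadic_boxes_le d0 hD.
have [->//|k0] := posnP #|dyadic_boxes d m|.
move: (_ * 2 ^ m)%N => C fC; rewrite -(leq_exp2r _ _ k0).
apply: leq_trans (expnn_le_fact _) _.
by rewrite expnMn leq_mul2l fC orbT.
Qed.

(** A shape r of total level m has a product of 2^(r i), that is 2^m, positions. *)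
Lemma card_dyadic_boxes d m : #|dyadic_boxes d m| =
  (#|[set r : {ffun 'I_d -> 'I_m.+1} | \sum_i (r i : nat) == m]| * 2 ^ m)%N.
Proof.
rewrite -sum1_card -sum_nat_const.
transitivity (\sum_(r : {ffun 'I_d -> 'I_m.+1} | \sum_i (r i : nat) == m)
  \sum_(p : {ffun 'I_d -> 'I_(2 ^ m)} | [forall i, p i < 2 ^ r i]) 1)%N.
  by rewrite pair_big_dep /=; apply: eq_bigl => b; rewrite inE.
apply: eq_big => [r|r /eqP rm]; first by rewrite inE.
rewrite sum1dep_card cardsE.
have E (i : 'I_d) : #|[pred x : 'I_(2 ^ m) | (x < 2 ^ r i)%N]| = (2 ^ r i)%N.
  have le : (2 ^ r i <= 2 ^ m)%N by rewrite leq_exp2l // -ltnS.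
  by rewrite -sum1_card -(big_ord_widen _ (fun=> 1%N) le) sum1_card card_ord.
rewrite -[X in _ = (2 ^ X)%N]rm expn_sum -(eq_bigr _ (fun i _ => E i)).
transitivity #|family (fun i : 'I_d => [pred x : 'I_(2 ^ m) | (x < 2 ^ r i)%N])|.
  by apply: eq_card => p; rewrite !inE; apply/forallP/familyP.
by rewrite card_family foldrE big_map big_enum.
Qed.

(** Choose d levels freely in 0, ..., mu; their sum is at most d mu, and coordinate 0 takes the
    rest. *)
Lemma card_shapes_ge d mu : (mu.+1 ^ d <=
  #|[set r : {ffun 'I_d.+1 -> 'I_(d * mu).+1} | \sum_i (r i : nat) == (d * mu)%N]|)%N.
Proof.
rewrite -[d in (_ ^ d)%N]card_ord -[mu.+1]card_ord -card_ffun.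
pose top (s : {ffun 'I_d -> 'I_mu.+1}) := (d * mu - \sum_i s i)%N.
pose F (s : {ffun 'I_d -> 'I_mu.+1}) : {ffun 'I_d.+1 -> 'I_(d * mu).+1} :=
  [ffun i => if unlift ord0 i is Some j then inord (s j) else inord (top s)].
have sle (s : {ffun 'I_d -> 'I_mu.+1}) : (\sum_i s i <= d * mu)%N.
  rewrite -[d in (_ <= d * _)%N]card_ord -sum_nat_const.
  by apply: leq_sum => i _; rewrite -ltnS.
have dle (s : {ffun 'I_d -> 'I_mu.+1}) j : (s j < (d * mu).+1)%N.
  by rewrite ltnS; apply: leq_trans (sle s); rewrite (bigD1 j) //= leq_addr.
have F0 s : F s ord0 = top s :> nat.
  by rewrite ffunE unlift_none inordK // ltnS leq_subr.
have FS s j : F s (lift ord0 j) = s j :> nat.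
  by rewrite ffunE liftK inordK.
have Finj : injective F.
  by move=> s s' E; apply/ffunP=> j; apply: val_inj; rewrite /= -!FS E.
rewrite -(card_codom Finj) -cardsE subset_leq_card //.
apply/subsetP=> r; rewrite !inE => /codomP[s ->].
rewrite big_ord_recl F0 (eq_bigr _ (fun j _ => FS s j)) subnK //.
Qed.

Lemma herdisc_below_ge d mu D : herdisc_below_le d.+1 (d * mu) D ->
  (mu.+1 ^ d <= 4 * 8 ^ d.+1 * (2 * D).+1)%N.
Proof.
move=> hD; have := card_dyadic_boxes_le (ltn0Sn d) hD.
rewrite card_dyadic_boxes.
have -> : (4 * ((2 * D).+1 * 8 ^ d.+1 * 2 ^ (d * mu)) =
  4 * 8 ^ d.+1 * (2 * D).+1 * 2 ^ (d * mu))%N by ring.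
rewrite leq_pmul2r ?expn_gt0 //; exact: leq_trans (card_shapes_ge d mu).
Qed.

(** * From box discrepancy to hereditary discrepancy *)

Lemma box_disc_attained d n (p : 'I_n -> 'rV[R]_d) :
  exists x, box_disc p = box_disc_of p x.
Proof.
rewrite /box_disc; elim/big_ind: _ => [|u v [x ->] [y ->]|x _].
- by exists [ffun => true].
- by rewrite /minn; case: ifP => _; [exists x | exists y].
- by exists x.
Qed.

Lemma box_disc_of_ge d n (p : 'I_n -> 'rV[R]_d) x S :
  box_induced p S -> (`|col_sum x S| <= box_disc_of p x)%N.
Proof.
move=> Sp; rewrite /box_disc_of.
by rewrite (leq_bigmax_cond (F := fun S => `|col_sum x S|%N)) //; apply/asboolP.
Qed.

(** Forces n to be large: discrepancy above N requires more than N points. *)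
Lemma box_disc_le_size d n (p : 'I_n -> 'rV[R]_d) : (box_disc p <= n)%N.
Proof.
have [x ->] := box_disc_attained p; apply/bigmax_leqP => S _.
apply: leq_trans (_ : #|S| <= n)%N; last by rewrite -[n in (_ <= n)%N]card_ord max_card.
rewrite -sum1_card -lez_nat abszE /col_sum (big_morph Posz PoszD (erefl _)).
apply: le_trans (ler_norm_sum _ _ _) _.
by apply: ler_sum => i _; case: (x i).
Qed.

Definition grid_point d n (x : {ffun 'I_d -> 'I_n}) : 'rV[R]_d := \row_i (x i : nat)%:R.

Lemma grid_point_inj d n : injective (@grid_point d n).
Proof.
move=> x y /rowP xy; apply/ffunP=> i; apply: val_inj.
by have /eqP := xy i; rewrite !mxE eqr_nat => /eqP.
Qed.

Lemma below_box_induced d m n (e : 'I_n -> {ffun 'I_d -> 'I_(4 * 2 ^ m)}) y :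
  box_induced (fun t => grid_point (e t)) [set t | below y (e t)].
Proof.
(* On integer coordinates x < y means x <= y - 1, which makes the box closed; y i = 0 gives an empty
   one. *)
exists (\row_i 0), (\row_i ((y i : nat)%:R - 1)) => t; rewrite inE.
split=> [/forallP lt i|box].
  by rewrite !mxE ler0n lerBrDr natr1 ler_nat lt.
apply/forallP=> i; have [_] := box i.
by rewrite !mxE lerBrDr natr1 ler_nat.
Qed.

(** An optimal colouring of the points indexed by O, extended by zero to the other columns, has the
    prescribed parities. *)
Lemma herdisc_below_box_disc d m D :
    (forall n (e : 'I_n -> {ffun 'I_d -> 'I_(4 * 2 ^ m)}), injective e ->
      (box_disc (fun t => grid_point (e t)) <= D)%N) ->
  herdisc_below_le d m D.
Proof.
move=> discD l f g gi O.
pose e (t : 'I_#|O|) := g (enum_val t).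
have ei : injective e by move=> s t /gi/enum_val_inj.
have := discD _ e ei; have [x ->] := box_disc_attained (fun t => grid_point (e t)) => xD.
(* The sum has one term for j in O and none otherwise; this form lets the sums over j and t be
   exchanged. *)
exists (\col_j \sum_(t < #|O| | enum_val t == j) (if x t then 1 else -1)) => [j|i].
  rewrite mxE; have [Oj|Oj] := boolP (O j).
    have jO : j \in O by [].
    rewrite (big_pred1 (enum_rank_in jO j)) => [|t /=]; first by case: (x _).
    by rewrite -(inj_eq enum_val_inj) enum_rankK_in.
  rewrite big_pred0 ?subr0 ?dvdz0 // => t; apply/eqP => tj.
  by have := enum_valP t; rewrite tj unfold_in (negPf Oj).
apply: le_trans (_ : (box_disc_of (fun t => grid_point (e t)) x)%:Z <= _); last by rewrite lez_nat.
apply: le_trans (_ : `|col_sum x [set t | below (f i) (e t)]| <= _); last first.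
  by rewrite -abszE lez_nat; apply: box_disc_of_ge; apply: below_box_induced.
rewrite le_eqVlt; apply/orP; left; apply/eqP; congr `|_|.
rewrite mxE /col_sum [RHS]big_mkcond /=.
under eq_bigr => j _ do rewrite !mxE big_distrr /=.
rewrite (exchange_big_dep xpredT) //=; apply: eq_bigr => t _.
rewrite (big_pred1 (enum_val t)) => [|j]; last by rewrite /= eq_sym.
by rewrite inE; case: below; rewrite ?mul1r ?mul0r.
Qed.

(** * Logarithms and the choice of constants *)

Lemma ler_ln (x y : R) : 0 < x -> x <= y -> Rpower.ln x <= Rpower.ln y.
Proof.
move=> x0; rewrite le_eqVlt => /orP[/eqP->//|xy].
by apply/ltW/RltP/Rpower.ln_increasing; apply/RltP.
Qed.

Lemma ln_expn2_le M : Rpower.ln (2 ^ M)%:R <= M%:R.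
Proof.
have ln2 : Rpower.ln 2%:R <= 1.
  rewrite -[X in _ <= X](Rpower.ln_exp 1); apply: ler_ln; first by rewrite ltr0n.
  by apply/RleP; apply: Rpower.exp_ineq1_le.
elim: M => [|M IH]; first by rewrite expn0 Rpower.ln_1.
rewrite expnS natrM Rpower.ln_mult; try by apply/RltP; rewrite ltr0n ?expn_gt0.
by rewrite -[M.+1%:R]natr1 [X in _ <= X]addrC; exact: lerD ln2 IH.
Qed.

(** By contraposition: the determinant argument needs all subsets of the grid to have small
    discrepancy, so it yields some subset with a large one. *)
Lemma box_disc_grid_gt d mu D : (4 * 8 ^ d.+1 * (2 * D).+1 < mu.+1 ^ d)%N ->
  exists n (e : 'I_n -> {ffun 'I_d.+1 -> 'I_(4 * 2 ^ (d * mu))}),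
    injective e /\ (D < box_disc (fun t => grid_point (e t)))%N.
Proof.
move=> muD; apply: contrapT => noe.
suff /herdisc_below_box_disc/herdisc_below_ge :
    forall n (e : 'I_n -> {ffun 'I_d.+1 -> 'I_(4 * 2 ^ (d * mu))}), injective e ->
      (box_disc (fun t => grid_point (e t)) <= D)%N by rewrite leqNgt muD.
by move=> n e ei; rewrite leqNgt; apply/negP => De; apply: noe; exists n, e.
Qed.

(** The size of the subset is unknown, but the logarithm of the grid size is already linear in
    mu. *)
Lemma ln_grid_subset_le d mu n (e : 'I_n -> {ffun 'I_d.+1 -> 'I_(4 * 2 ^ (d * mu))}) :
  injective e -> (0 < n)%N -> Rpower.ln n%:R <= (d.+2 * d.+1 * mu.+1)%:R.
Proof.
move=> ei n0; have := leq_card _ ei; rewrite card_ffun !card_ord => nN.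
apply: le_trans (ln_expn2_le _); apply: ler_ln; rewrite ?ltr0n // ler_nat.
apply: leq_trans nN _; rewrite -[4%N]/(2 ^ 2)%N -expnD -expnM leq_exp2l //.
by nia.
Qed.

Theorem theorem1p1 :
  forall d : nat, (2 <= d)%N ->
  exists c : R, (0 < c)%R /\
    forall N : nat, exists n : nat, (N <= n)%N /\
      exists p : 'I_n -> 'rV[R]_d, injective p /\
        (c * (Rpower.ln n%:R) ^+ (d - 1) <= (box_disc p)%:R)%R.
Proof.
case=> [//|d]; rewrite ltnS subn1 /= => d0.
(* For D >= 1, 4 (2D + 1) < 16 D explains a; b is the d-th power of the constant bounding ln n / (mu
   + 1). *)
pose a := (16 * 8 ^ d.+1)%N; pose b := ((d.+2 * d.+1) ^ d)%N.
have a0 : (0 < a)%N by rewrite muln_gt0 expn_gt0.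
have ab0 : (0 < a * b)%N by rewrite muln_gt0 a0 expn_gt0.
exists (a * b)%:R^-1; split; first by rewrite invr_gt0 ltr0n.
(* As d >= 1, (mu + 1)^d >= mu + 1 > a (N + 1), so D exceeds N. *)
move=> N; pose mu := (a * N.+1)%N; pose D := (mu.+1 ^ d %/ a)%N.
have DN : (N < D)%N.
  rewrite /D leq_divRL // mulnC; apply: leq_trans (leqnSn _) _.
  by rewrite -[X in (X <= _)%N]expn1 leq_pexp2l.
have aD : (a * D <= mu.+1 ^ d)%N by rewrite mulnC leq_trunc_div.
have [|n [e [ei De]]] := @box_disc_grid_gt d mu D.
  by apply: leq_trans aD; rewrite /a; have := expn_gt0 8 d.+1; nia.
have Nn : (N < n)%N.
  by apply: leq_trans (box_disc_le_size _); apply: leq_trans De; apply: leqW.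
exists n; split; first exact: ltnW.
exists (fun t => grid_point (e t)); split; first by move=> s t /grid_point_inj/ei.
have n0 : (0 < n)%N by apply: leq_ltn_trans Nn.
rewrite mulrC ler_pdivrMr ?ltr0n //.
apply: le_trans (_ : (b * mu.+1 ^ d)%:R <= _).
  rewrite -expnMn natrX lerXn2r ?nnegrE ?ler0n //; last exact: ln_grid_subset_le ei n0.
  by have := @ler_ln 1 n%:R ltr01; rewrite Rpower.ln_1 ler1n; apply.
rewrite -natrM ler_nat mulnA [leqLHS]mulnC leq_mul2r; apply/orP; right.
(* The strict bound D < disc absorbs the rounding in D: (mu + 1)^d < a (D + 1) <= a disc. *)
by apply: leq_trans (ltnW (ltn_ceil _ a0)) _; rewrite leq_mul2r De orbT.
Qed.
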